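(* Let $A\in\mathbb{C}^{m\times n}$ be nonzero, let $p=\min\{m,n\}$, and let the Gaussian random re-normalization algorithm (described in the context) be implemented on $A$. Suppose it has produced $Q_k=[q_1,\ldots,q_k]$, and let $b_{k+1,k+1}$ be the diagonal entry computed in step $k+1$. Set $\hat{A}=Q_kQ_k^{\mathrm{H}}A$. Then, for any $0\le\epsilon<1$, the expectation of $b_{k+1,k+1}^2$ (with respect to the Gaussian vector $\omega_{k+1}$, with $Q_k$ fixed) satisfies $$\mathbb{E}\, b_{k+1,k+1}^2\le \|A\|_{\mathrm{F}}^2\,\epsilon$$ if and only if $$\frac{\|A-\hat{A}\|_{\mathrm{F}}}{\|A\|_{\mathrm{F}}}\le\sqrt{\epsilon}.$$ In this case, $$\frac{\sum_{i=1}^{k}\sigma_i^2(A)}{\sum_{i=1}^{p}\sigma_i^2(A)}\ge 1-\epsilon,$$ and the $\epsilon$-rank of $A$ is $r_\epsilon=k$.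
   Context: Notation: $A^{\mathrm{H}}$ is the conjugate transpose, $\|\cdot\|_{\mathrm{F}}$ the Frobenius norm, $\|\cdot\|_2$ the spectral (Euclidean) norm, and $\sigma_1(A)\ge\cdots\ge\sigma_p(A)\ge 0$ are the singular values of $A$, $p=\min\{m,n\}$. $\epsilon$-rank: for $0\le\epsilon<1$, the $\epsilon$-rank of $A$ is $$r_\epsilon=\min\Big\{s: 1\le s\le p,\ \frac{\sum_{i=1}^{s}\sigma_i^2(A)}{\sum_{i=1}^{p}\sigma_i^2(A)}\ge 1-\epsilon\Big\}.$$ Gaussian random re-normalization algorithm, with input $A\in\mathbb{C}^{m\times n}$: for $k=1,2,\ldots,n$, draw (independently of the previous draws) a vector $\omega_k\in\mathbb{R}^n$ with independent $\mathcal{N}(0,1)$ entries; compute $v_k=\big(I-\sum_{l=1}^{k-1}q_lq_l^{\mathrm{H}}\big)A\omega_k$ and $b_{kk}=\|v_k\|_2$; if $b_{kk}^2>0$, set $q_k=v_k/b_{kk}$ and continue; otherwise stop. Write $Q_k=[q_1,\ldots,q_k]\in\mathbb{C}^{m\times k}$, which has orthonormal columns.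
   Formalization: The claim that the ε-rank equals k is false as stated (A = I_3, ε = 9/10, k = 2 gives r_ε = 1); it is replaced by r_ε ≤ k, with r_ε = k when no s with 1 ≤ s < k has energy ratio at least 1−ε. *)

(* Defs.v *)
From HB Require Import structures.
From mathcomp Require Import all_boot all_order all_algebra.
From mathcomp Require Import all_classical all_reals all_analysis.
From mathcomp.real_closed Require Import complex.

Set Implicit Arguments.
Unset Strict Implicit.
Unset Printing Implicit Defensive.

Import Order.TTheory GRing.Theory Num.Theory.
Import numFieldNormedType.Exports.

Local Open Scope classical_set_scope.
Local Open Scope ring_scope.
Local Open Scope sesquilinear_scope.
Local Open Scope complex_scope.

(* Normc.normc z : R is the modulus of z : R[i] as a real number. *)
Definition norm2 (R : realType) (m : nat) (v : 'cV[R[i]]_m) : R :=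
  Num.sqrt (\sum_(i < m) Normc.normc (v i 0) ^+ 2).

Definition normF (R : realType) (m n : nat) (A : 'M[R[i]]_(m, n)) : R :=
  Num.sqrt (\sum_(i < m) \sum_(j < n) Normc.normc (A i j) ^+ 2).

(* sigma A i is the (i + 1)-st singular value of A: square roots of the n
   eigenvalues of A^H A, counted with multiplicity, in nonincreasing order.
   All those with i >= minn m n vanish. *)
Definition sigma (R : realType) (m n : nat) (A : 'M[R[i]]_(m, n)) (i : nat) : R :=
  nth 0 (sort >=%R
    [seq Num.sqrt (complex.Re (spectral_diag (A ^t* *m A) 0 j)) | j : 'I_n]) i.

Definition energy_ratio (R : realType) (m n : nat) (A : 'M[R[i]]_(m, n))
    (s : nat) : R :=
  (\sum_(i < s) sigma A i ^+ 2) / (\sum_(i < minn m n) sigma A i ^+ 2).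

(* The default value minn m n of the minimum belongs to the minimised set
   as soon as A != 0 and 0 <= eps, since energy_ratio A (minn m n) = 1. *)
Definition eps_rank (R : realType) (m n : nat) (A : 'M[R[i]]_(m, n))
    (eps : R) : nat :=
  \big[minn/minn m n]_(1 <= s < (minn m n).+1 | 1 - eps <= energy_ratio A s) s.

Section Algorithm.
Context (R : realType) (m n : nat) (A : 'M[R[i]]_(m, n)).
Implicit Types (qs : seq 'cV[R[i]]_m) (w : 'cV[R]_n).

Definition grr_v qs w : 'cV[R[i]]_m :=
  (1%:M - \sum_(q <- qs) q *m q ^t* ) *m A *m map_mx (real_complex R) w.

Definition grr_b qs w : R := norm2 (grr_v qs w).

(* None means that the algorithm has stopped. *)
Definition grr_step (oqs : option (seq 'cV[R[i]]_m)) w :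
    option (seq 'cV[R[i]]_m) :=
  if oqs is Some qs then
    if 0 < grr_b qs w ^+ 2
    then Some (rcons qs (((grr_b qs w)^-1)%:C *: grr_v qs w))
    else None
  else None.

(* The first k steps; ws l is the draw of step l + 1. *)
Definition grr (ws : 'I_n -> 'cV[R]_n) (k : nat) :
    option (seq 'cV[R[i]]_m) :=
  foldl grr_step (Some [::]) [seq ws l | l : 'I_n <- enum 'I_n & (l < k)%N].

Definition grr_Q (k : nat) qs : 'M[R[i]]_(m, k) :=
  \matrix_(i < m, j < k) nth 0 qs j i 0.

End Algorithm.

Section Gaussian.
Context (d : measure_display) (T : measurableType d) (R : realType).
Context (P : probability T R).

Definition mutually_independent (I : finType) (X : I -> {RV P >-> R}) : Prop :=
  forall (J : {set I}) (B : I -> set R), (forall i, measurable (B i)) ->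
    P (\bigcap_(i in [set` J]) X i @^-1` B i) =
    (\prod_(i in J) P (X i @^-1` B i))%E.

Definition standard_normal (X : {RV P >-> R}) : Prop :=
  forall B : set R, measurable B -> distribution P X B = normal_prob 0 1 B.

(* omega l i is entry i of the vector drawn at step l + 1; all the entries
   of all the vectors are jointly independent. *)
Definition gaussian_draws (n : nat) (omega : 'I_n -> 'I_n -> {RV P >-> R}) :
    Prop :=
  (forall l i, standard_normal (omega l i)) /\
  mutually_independent (fun li : 'I_n * 'I_n => omega li.1 li.2).

Definition draw (n : nat) (omega : 'I_n -> 'I_n -> {RV P >-> R}) (t : T)
    (l : 'I_n) : 'cV[R]_n := \col_(i < n) omega l i t.

End Gaussian.

(* Main.v *)
Require Import Defs.
From HB Require Import structures.
From mathcomp Require Import all_boot all_order all_algebra.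
From mathcomp Require Import all_classical all_reals all_analysis.
From mathcomp.real_closed Require Import complex.
From mathcomp Require Import measurable_realfun ring lra.

Set Implicit Arguments.
Unset Strict Implicit.
Unset Printing Implicit Defensive.

Import Order.TTheory GRing.Theory Num.Theory.
Import numFieldNormedType.Exports.

Local Open Scope classical_set_scope.
Local Open Scope ring_scope.
Local Open Scope sesquilinear_scope.
Local Open Scope complex_scope.

(** Once the vectors [q_1, ..., q_k] are fixed, the vector computed in step
    [k + 1] is [(A - Ahat) *m w] with [w] a fresh standard Gaussian vector. Its
    squared norm is a quadratic form in [w], and the entries of [w] have unit
    second moments and vanishing mixed moments, so that only the diagonal of
    the form survives in expectation: the mean of the squared norm is exactly
    [normF (A - Ahat) ^+ 2] ([expectation_norm2_sq]). The announced
    equivalence is then the squaring of an inequality between nonnegative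
    reals. The moments of the Gaussian come from the symmetry of the density
    [phi] and from the primitive [x * phi x] of [(1 - x ^+ 2) * phi x]; mixed
    moments vanish because the joint law of two independent variables is the
    product of their laws, to which Fubini applies.

    For the singular values, [Ahat] factors through a space of dimension [k],
    so its rank is at most [k], and the Eckart-Young inequality
    ([eckart_young]) says that a matrix of rank at most [k] misses at least
    the energy carried by the singular values beyond the first [k]:
    [normF A ^+ 2 - \sum_(i < k) sigma A i ^+ 2 <= normF (A - Ahat) ^+ 2].
    As [normF A ^+ 2] is the total energy ([sum_sigma_sq]), a relative error of
    at most [eps] forces the first [k] singular values to carry the fraction
    [1 - eps]. The Eckart-Young inequality is obtained by projecting onto the
    row space of the low-rank matrix: Pythagoras reduces it to Ky Fan's bound
    ([ky_fan]) on the energy of [A] in an [r]-dimensional space, and that bound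
    holds because this energy is a combination of the squared singular values
    with weights in [[0, 1]] that sum to [r], which is largest when the weights
    sit on the [r] largest values.

    The [eps]-rank is a minimum over the [s] whose energy ratio reaches
    [1 - eps]; the step [k] is such an [s], and it is the least one as soon as
    no earlier step qualifies. *)

(** * Frobenius norm, singular values and low-rank approximation *)

Section LowRank.
Context (R : realType).
Implicit Types m n r k : nat.

Lemma normc_sqC (z : R[i]) : ((Normc.normc z) ^+ 2)%:C = z * Num.conj z.
Proof. by rewrite -normCK rmorphXn. Qed.

Lemma normF_sq m n (A : 'M[R[i]]_(m, n)) :
  normF A ^+ 2 = \sum_i \sum_j Normc.normc (A i j) ^+ 2.
Proof.
by rewrite sqr_sqrtr//; do 2![apply: sumr_ge0 => ? _]; exact: sqr_ge0.
Qed.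

Lemma trmxC_mul m n r (A : 'M[R[i]]_(m, n)) (B : 'M[R[i]]_(n, r)) :
  (A *m B)^t* = B^t* *m A^t*.
Proof. by rewrite trmx_mul map_mxM. Qed.

Lemma trmxC_sub m n (A B : 'M[R[i]]_(m, n)) : (A - B)^t* = A^t* - B^t*.
Proof. by rewrite linearB /= raddfB. Qed.

Lemma mulmx_trC_diag m n (A : 'M[R[i]]_(m, n)) i :
  (A *m A^t* ) i i = (\sum_j Normc.normc (A i j) ^+ 2)%:C.
Proof.
rewrite mxE rmorph_sum /=; apply: eq_bigr => j _.
by rewrite !mxE normc_sqC.
Qed.

Lemma trC_mulmx_diag m n (A : 'M[R[i]]_(m, n)) j :
  (A^t* *m A) j j = (\sum_i Normc.normc (A i j) ^+ 2)%:C.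
Proof.
rewrite mxE rmorph_sum /=; apply: eq_bigr => i _.
by rewrite !mxE normc_sqC mulrC.
Qed.

(** The trace form makes the Frobenius norm accessible to matrix algebra:
    cyclicity of the trace and unitarity do the rest below. *)
Lemma normF_trace m n (A : 'M[R[i]]_(m, n)) :
  (normF A ^+ 2)%:C = \tr (A *m A^t* ).
Proof.
by rewrite normF_sq rmorph_sum /=; apply: eq_bigr => i _; rewrite mulmx_trC_diag.
Qed.

Lemma normF_sq_eq0 m n (A : 'M[R[i]]_(m, n)) : (normF A ^+ 2 == 0) = (A == 0).
Proof.
apply/idP/eqP => [|->]; last first.
  rewrite normF_sq big1// => i _; rewrite big1// => j _.
  by rewrite mxE Normc.normc0 expr0n.
rewrite normF_sq psumr_eq0; last by move=> i _; apply: sumr_ge0 => *; exact: sqr_ge0.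
move=> /allP A0; apply/matrixP => i j; rewrite mxE.
have := A0 i (mem_index_enum _); rewrite psumr_eq0; last by move=> *; exact: sqr_ge0.
by move=> /allP/(_ j (mem_index_enum _)); rewrite sqrf_eq0 => /eqP/Normc.eq0_normc.
Qed.

(** The rows of [V] are an orthonormal basis of a subspace; [A *m V^t* *m V]
    projects the rows of [A] onto it, and [A *m V^t*] holds the coordinates of
    these projections in that basis, hence has the same norm. *)
Lemma normF_pythagoras m n r (A : 'M[R[i]]_(m, n)) (V : 'M[R[i]]_(r, n)) :
  V \is unitarymx ->
  normF A ^+ 2 = normF (A *m V^t* ) ^+ 2 + normF (A - A *m V^t* *m V) ^+ 2.
Proof.
move=> /unitarymxP VV; apply: (@complexI R); rewrite rmorphD /= !normF_trace.
rewrite trmxC_sub !trmxC_mul trmxCK -[LHS]addr0 -raddfD /= addr0.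
congr mxtrace.
rewrite mulmxBl !mulmxBr !mulmxA.
by rewrite -(mulmxA (A *m V^t* ) V (V^t* )) VV mulmx1 subrr subr0 addrC subrK.
Qed.

(** With [t] the square of the [(r + 1)]-st largest value,
    [c j * s j ^+ 2 <= Num.max (s j ^+ 2 - t) 0 + t * c j]. The sum of the
    maxima does not depend on the order of the values, and on the sorted list
    only the first [r] of them can be nonzero, so it equals
    [\sum_(i < r) (L`_i ^+ 2 - t)]; the weights contribute at most [t *+ r]. *)
Lemma sum_weighted_le_sorted n r (s c : 'I_n -> R) :
  (forall j, 0 <= s j) -> (forall j, 0 <= c j <= 1) ->
  \sum_j c j <= r%:R ->
  \sum_j c j * s j ^+ 2 <=
    \sum_(i < r) (nth 0 (sort >=%R [seq s j | j : 'I_n]) i) ^+ 2.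
Proof.
move=> s0 c01 cr; set L := sort _ _.
have sL : size L = n by rewrite size_sort size_map size_enum_ord.
have L0 i : 0 <= L`_i.
  have [iL|iL] := ltnP i (size L); last by rewrite nth_default.
  have : L`_i \in L by rewrite mem_nth.
  by rewrite mem_sort => /mapP[j _ ->].
have srtL : sorted >=%R L by apply: sort_sorted => x y; exact: le_total.
have Lle i j : (i <= j)%N -> L`_j <= L`_i.
  move=> ij; have [jL|jL] := ltnP j (size L); last by rewrite (nth_default _ jL).
  apply: (sorted_leq_nth _ _ 0 srtL) => //; [|exact: lexx|by rewrite inE (leq_ltn_trans ij)].
  by move=> x y z /= yx zy; exact: le_trans yx.
pose t := L`_r ^+ 2.
pose g (x : R) := Num.max (x ^+ 2 - t) 0.
have gL : \sum_j g (s j) = \sum_(0 <= i < n) g L`_i.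
  rewrite -[in RHS]sL -(big_nth 0 xpredT g) (perm_big [seq s j | j : 'I_n]).
    by rewrite big_map big_enum.
  by rewrite perm_sort.
have g0 x : 0 <= g x by rewrite /g le_max lexx orbT.
have le1 : \sum_j c j * s j ^+ 2 <= \sum_j g (s j) + t *+ r.
  apply: (@le_trans _ _ (\sum_j (g (s j) + t * c j))).
    apply: ler_sum => j _; have /andP[c0 c1] := c01 j.
    rewrite -lerBlDr (mulrC t) -mulrBr.
    apply: (@le_trans _ _ (c j * g (s j))).
      by rewrite ler_wpM2l// /g le_max lexx.
    by rewrite ler_piMl.
  rewrite big_split /= lerD2l -mulr_sumr -mulr_natr.
  by rewrite ler_wpM2l// sqr_ge0.
apply: (le_trans le1); rewrite gL.
have -> : \sum_(i < r) L`_i ^+ 2 = \sum_(i < r) g L`_i + t *+ r.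
  rewrite -[X in t *+ X](card_ord r) -sumr_const -big_split/=; apply: eq_bigr => i _.
  rewrite /g max_l ?subrK// subr_ge0 ler_sqr ?nnegrE ?L0//.
  by apply: Lle; exact: ltnW.
rewrite lerD2r -(big_mkord xpredT (fun i => g L`_i)).
have gr i : (r <= i)%N -> g L`_i = 0.
  by move=> ri; rewrite /g max_r// subr_le0 ler_sqr ?nnegrE ?L0// Lle.
have [rn|nr] := leqP r n.
  rewrite (big_cat_nat (leq0n r) rn)//= [X in _ + X]big1_seq ?addr0// => i.
  by rewrite mem_index_iota => /andP[_ /andP[/gr]].
rewrite (big_cat_nat (leq0n n) (ltnW nr))//= lerDl.
by apply: sumr_ge0 => i _.
Qed.

Lemma gram_spectral m n (A : 'M[R[i]]_(m, n)) (G := A^t* *m A) :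
  G = (spectralmx G)^t* *m diag_mx (spectral_diag G) *m spectralmx G.
Proof.
rewrite -invmx_unitary ?spectral_unitarymx//; apply/orthomx_spectralP.
by apply/normalmxP; rewrite trmxC_mul trmxCK.
Qed.

(** The eigenvalues of [A^t* *m A] are the squared column norms of [A *m U^t*],
    with [U] the diagonalising unitary matrix: this makes them real and
    nonnegative, so that passing through [complex.Re] and [Num.sqrt] loses
    nothing. *)
Lemma spectral_diag_gram m n (A : 'M[R[i]]_(m, n)) (G := A^t* *m A) j :
  spectral_diag G 0 j =
    (Num.sqrt (complex.Re (spectral_diag G 0 j)) ^+ 2)%:C.
Proof.
have UU := elimT unitarymxP (spectral_unitarymx G).
set U := spectralmx G in UU.
have : (A *m U^t* )^t* *m (A *m U^t* ) = diag_mx (spectral_diag G).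
  rewrite trmxC_mul trmxCK -mulmxA (mulmxA (A^t* )) [in LHS](gram_spectral A).
  by rewrite -/G -/U !mulmxA UU mul1mx -mulmxA UU mulmx1.
move=> /matrixP/(_ j j); rewrite trC_mulmx_diag [in RHS]mxE eqxx mulr1n => <- /=.
by rewrite sqr_sqrtr//; apply: sumr_ge0 => i _; exact: sqr_ge0.
Qed.

(** In the eigenbasis of the Gram matrix the energy of [A] in the space spanned
    by the rows of [V] is a weighted sum of its squared singular values; the
    [j]-th weight is the squared norm of the [j]-th column of [V *m U^t*]. *)
Lemma normF_mul_trC m n r (A : 'M[R[i]]_(m, n)) (G := A^t* *m A)
    (V : 'M[R[i]]_(r, n)) :
  normF (A *m V^t* ) ^+ 2 =
  \sum_j (\sum_i Normc.normc ((V *m (spectralmx G)^t* ) i j) ^+ 2) *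
    Num.sqrt (complex.Re (spectral_diag G 0 j)) ^+ 2.
Proof.
apply: (@complexI R); rewrite normF_trace mxtrace_mulC trmxC_mul trmxCK.
rewrite mulmxA -(mulmxA V) [in LHS](gram_spectral A) -/G.
set W := V *m (spectralmx G)^t*.
have -> : V *m ((spectralmx G)^t* *m diag_mx (spectral_diag G) *m spectralmx G)
   *m V^t* = W *m diag_mx (spectral_diag G) *m W^t*.
  by rewrite /W trmxC_mul trmxCK !mulmxA.
rewrite -mulmxA mxtrace_mulC -mulmxA rmorph_sum /=; apply: eq_bigr => j _.
rewrite mul_diag_mx mxE trC_mulmx_diag mulrC rmorphM /=; congr (_ * _).
exact: spectral_diag_gram.
Qed.

(** [E = 1 - W^t* *m W] is an orthogonal projector, so [E = E *m E^t*] and its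
    diagonal, whose [j]-th entry is [1] minus the sum at hand, is
    nonnegative. *)
Lemma unitary_col_le1 n r (W : 'M[R[i]]_(r, n)) j : W \is unitarymx ->
  \sum_i Normc.normc (W i j) ^+ 2 <= 1.
Proof.
move=> /unitarymxP WW; rewrite -subr_ge0 -(@lecR R).
pose E := 1%:M - W^t* *m W.
have EE : E *m E^t* = E.
  rewrite /E trmxC_sub trmxC_mul trmxCK trmx1 map_mx1.
  rewrite mulmxBl mul1mx mulmxBr mulmx1 mulmxA -(mulmxA _ W) WW mulmx1.
  by rewrite subrr subr0.
have -> : (1 - \sum_i Normc.normc (W i j) ^+ 2)%:C = E j j.
  by rewrite rmorphB rmorph1 /= -trC_mulmx_diag /E !mxE eqxx.
rewrite -EE mulmx_trC_diag lecR.
by apply: sumr_ge0 => i _; exact: sqr_ge0.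
Qed.

Lemma unitary_sum_sq n r (W : 'M[R[i]]_(r, n)) : W \is unitarymx ->
  \sum_j \sum_i Normc.normc (W i j) ^+ 2 = r%:R.
Proof.
move=> /unitarymxP WW; rewrite exchange_big -normF_sq; apply: (@complexI R).
by rewrite normF_trace WW mxtrace1 rmorph_nat.
Qed.

(** The weights of [normF_mul_trC] lie in [[0, 1]] and sum to [r]. *)
Lemma ky_fan m n r (A : 'M[R[i]]_(m, n)) (V : 'M[R[i]]_(r, n)) :
  V \is unitarymx ->
  normF (A *m V^t* ) ^+ 2 <= \sum_(i < r) sigma A i ^+ 2.
Proof.
move=> uV; rewrite normF_mul_trC.
have uW : V *m (spectralmx (A^t* *m A))^t* \is unitarymx.
  by rewrite mul_unitarymx// trmxC_unitary spectral_unitarymx.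
apply: sum_weighted_le_sorted => [j|j|]; first exact: sqrtr_ge0.
  by rewrite unitary_col_le1// andbT; apply: sumr_ge0 => i _; exact: sqr_ge0.
by rewrite unitary_sum_sq.
Qed.

(** Take for [V] an orthonormal basis of the row space of [B]. The projection
    onto the orthogonal complement of that space kills [B], so the part of
    [A - B] there is the part of [A] there, whose energy is that of [A] minus
    what [ky_fan] allows inside the row space. *)
Lemma eckart_young m n k (A B : 'M[R[i]]_(m, n)) : (\rank B <= k)%N ->
  normF A ^+ 2 - \sum_(i < k) sigma A i ^+ 2 <= normF (A - B) ^+ 2.
Proof.
move=> rBk.
have uV : schmidt (row_base B) \is unitarymx.
  by rewrite schmidt_unitarymx// rank_leq_col.
have BV : (B <= schmidt (row_base B))%MS.
  by rewrite (submx_trans _ (schmidt_sub _))// eq_row_base.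
set V := schmidt _ in uV BV.
have BVV : B *m V^t* *m V = B.
  have /submxP[C eB] := BV; transitivity (C *m V *m V^t* *m V); first by rewrite -eB.
  by rewrite -!mulmxA (mulmxA V) (elimT unitarymxP uV) mul1mx -eB.
have -> : normF (A - B) ^+ 2 = normF ((A - B) *m V^t* ) ^+ 2
    + (normF A ^+ 2 - normF (A *m V^t* ) ^+ 2).
  rewrite (normF_pythagoras (A - B) uV) (normF_pythagoras A uV).
  rewrite (addrAC (normF (A *m V^t* ) ^+ 2)) subrr add0r !mulmxBl BVV.
  by rewrite opprB addrA subrK.
apply: ler_wpDl; first exact: sqr_ge0.
rewrite lerB//; apply: (le_trans (ky_fan A uV)).
rewrite -!(big_mkord xpredT (fun i => sigma A i ^+ 2)).
by rewrite (big_cat_nat (leq0n _) rBk)//= lerDl sumr_ge0// => i _; exact: sqr_ge0.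
Qed.

(** All [n] squared singular values sum to the trace of the Gram matrix. That
    the first [minn m n] suffice is [eckart_young] for the approximation of
    [A] by itself, whose rank is at most [minn m n]. *)
Lemma sum_sigma_sq m n (A : 'M[R[i]]_(m, n)) :
  \sum_(i < minn m n) sigma A i ^+ 2 = normF A ^+ 2.
Proof.
apply/eqP; rewrite eq_le; apply/andP; split; last first.
  have rA : (\rank A <= minn m n)%N by rewrite leq_min rank_leq_row rank_leq_col.
  have := eckart_young A rA; rewrite subrr.
  have /eqP -> : normF (0 : 'M[R[i]]_(m, n)) ^+ 2 == 0 by rewrite normF_sq_eq0.
  by rewrite subr_le0.
have -> : normF A ^+ 2 = \sum_(i < n) sigma A i ^+ 2.
  (* For V = U the weights of normF_mul_trC are all 1. *)
  have := normF_mul_trC A (spectralmx (A^t* *m A)).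
  have uU := spectral_unitarymx (A^t* *m A).
  rewrite (elimT unitarymxP uU).
  set U := spectralmx _ in uU *.
  have := normF_pythagoras A uU; rewrite -mulmxA.
  have -> : U^t* *m U = 1%:M.
    by rewrite -invmx_unitary// mulVmx// unitarymx_unit.
  rewrite mulmx1 subrr.
  have /eqP -> : normF (0 : 'M[R[i]]_(m, n)) ^+ 2 == 0 by rewrite normF_sq_eq0.
  rewrite addr0 => <- ->.
  under eq_bigr => j _.
    rewrite (bigD1 j)//= big1 => [|i ij]; last first.
      by rewrite mxE (negbTE ij) Normc.normc0 expr0n.
    rewrite mxE eqxx Normc.normc1 expr1n addr0 mul1r. over.
  rewrite -(big_mkord xpredT (fun i => sigma A i ^+ 2)) /sigma.
  set L := sort _ _.
  have sL : size L = n by rewrite size_sort size_map size_enum_ord.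
  rewrite -[in RHS]sL -(big_nth 0 xpredT (fun x => x ^+ 2)).
  rewrite /L [RHS](perm_big _ (permEl (perm_sort _ _))).
  by rewrite big_map big_enum.
rewrite -!(big_mkord xpredT (fun i => sigma A i ^+ 2)).
by rewrite (big_cat_nat (leq0n _) (geq_minr m n))//= lerDl sumr_ge0// => i _; exact: sqr_ge0.
Qed.

End LowRank.

(** * Moments of the standard normal distribution *)

Section NormalMoments.
Context (R : realType).
Notation mu := (@lebesgue_measure R).
Notation phi := (@normal_pdf R 0 1).

(** [normal_pdf m s] satisfies the equations that determine the Radon-Nikodym
    derivative of [normal_prob m s] up to a null set. *)
Lemma ge0_integral_normal_prob (m s : R) (f : measurableTypeR R -> \bar R) :
  measurable_fun [set: R] f -> (forall x, 0 <= f x)%E ->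
  (\int[normal_prob m s]_x f x = \int[mu]_x (f x * (normal_pdf m s x)%:E))%E.
Proof.
move=> mf f0; have dom := normal_prob_dominates m s.
rewrite -(Radon_Nikodym_SigmaFinite.change_of_variables dom)//.
apply: ae_eq_integral => //.
- apply: emeasurable_funM => //.
  exact: measurable_int (Radon_Nikodym_SigmaFinite.f_integrable dom).
- apply: emeasurable_funM => //; apply/measurable_EFinP.
  exact: measurable_normal_pdf.
- apply: ae_eqe_mul2l; apply: integral_ae_eq => //.
  + exact: Radon_Nikodym_SigmaFinite.f_integrable.
  + by apply/measurable_EFinP; exact: measurable_normal_pdf.
  + by move=> E _ mE; rewrite -Radon_Nikodym_SigmaFinite.f_integral.
Qed.

Lemma normal_pdf01E (x : R) : phi x = normal_peak 1 * expR (- (x ^+ 2 / 2)).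
Proof.
by rewrite normal_pdfE ?oner_neq0// /normal_fun subr0 expr1n mulNr.
Qed.

Lemma normal_pdf01N (x : R) : phi (- x) = phi x.
Proof. by rewrite !normal_pdf01E sqrrN. Qed.

Lemma is_derive_normal_pdf01 (x : R) : is_derive x 1 phi (- (x * phi x)).
Proof.
have -> : phi = fun x => normal_peak 1 * expR (- (x ^+ 2 / 2)).
  by apply/funext => y; exact: normal_pdf01E.
apply: is_derive_eq.
rewrite !scaler0 add0r /GRing.scale/=; field => //.
Qed.

Lemma mul_normal_pdf01_cvg0 : x * phi x @[x --> +oo] --> (0 : R).
Proof.
(* expR (x ^+ 2 / 2) >= 1 + x ^+ 2 / 2 makes x * phi x at most 2 * phi 0 / x. *)
have cvg0 : (2 * normal_peak 1) * x^-1 @[x --> +oo] --> (0 : R).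
  rewrite -[X in _ --> X](mulr0 (2 * normal_peak 1)).
  by apply: cvgMr; apply/gtr0_cvgV0; [exact: nbhs_pinfty_gt|exact: cvg_id].
apply: (squeeze_cvgr _ _ cvg0); last exact: cvg_cst.
near=> x.
have x0 : 0 < x by near: x; exact: nbhs_pinfty_gt.
apply/andP; split; first by rewrite mulr_ge0 ?normal_pdf_ge0 ?ltW.
rewrite normal_pdf01E mulrCA.
rewrite [leRHS]mulrAC [leRHS]mulrC ler_pM2l ?normal_peak_gt0 ?oner_neq0//.
rewrite expRN ler_pdivrMr ?expR_gt0// mulrAC ler_pdivlMr// -expr2.
rewrite -ler_pdivrMl// mulrC.
apply: le_trans (expR_ge1Dx _); lra.
Unshelve. all: by end_near. Qed.

(** This primitive compares the second moment with the total mass: the two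
    integrals below evaluate it on either side of [1], where [1 - x ^+ 2]
    changes sign. *)
Lemma is_derive_mul_normal_pdf01 (x : R) :
  is_derive x 1 (fun y => y * phi y) ((1 - x ^+ 2) * phi x).
Proof.
have := is_derive_normal_pdf01 x => dphi.
apply: is_derive_eq; rewrite /GRing.scale/=; ring.
Qed.

Lemma continuous_normal_pdf01 : continuous phi.
Proof. exact: continuous_normal_pdf (oner_neq0 _). Qed.

Lemma continuous_mul_normal_pdf01 : continuous (fun x : R => x * phi x).
Proof.
by move=> x; apply: cvgM; [exact: cvg_id|exact: continuous_normal_pdf01].
Qed.

Lemma continuous_sq_mul_normal_pdf01 : continuous (fun x : R => x ^+ 2 * phi x).
Proof.
by move=> x; apply: cvgM; [exact: exprn_continuous|exact: continuous_normal_pdf01].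
Qed.

(** The half-line is cut at [1] because the fundamental theorem of calculus is
    applied there to an integrand of constant sign. *)
Lemma ge0_integral_split1 (f : R -> R) : (forall x, 0 <= f x) -> continuous f ->
  (\int[mu]_(x in `[0%R, +oo[) (f x)%:E =
   \int[mu]_(x in `[0%R, 1%R]) (f x)%:E + \int[mu]_(x in `[1%R, +oo[) (f x)%:E)%E.
Proof.
move=> f0 cf; have mf : measurable_fun [set: R] (EFin \o f).
  by apply/measurable_EFinP; exact: continuous_measurable_fun.
have -> : `[0%R, +oo[%classic = `[0%R, 1%R] `|` `]1%R, +oo[ :> set R.
  by rewrite -itv_bndbnd_setU//= ?bnd_simp.
rewrite ge0_integral_setU//=.
- by rewrite integral_itv_obnd_cbnd//; exact: measurable_funTS.
- exact: measurable_funTS.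
- by move=> x _; rewrite lee_fin.
- apply/disj_setPS => x [] /=; rewrite !in_itv/= andbT => /andP[_ x1].
  by rewrite ltNge x1.
Qed.

Lemma integral_sq_sub1_normal_pdf01 :
  (\int[mu]_(x in `[1%R, +oo[) ((x ^+ 2 - 1) * phi x)%:E = (phi 1)%:E)%E.
Proof.
rewrite (@ge0_continuous_FTC2y _ _ (fun x => - (x * phi x)) 1 0).
- by rewrite mul1r EFinN oppeK add0e.
- move=> x x1; rewrite mulr_ge0 ?normal_pdf_ge0// subr_ge0.
  by rewrite exprn_ege1.
- apply: continuous_subspaceT => x; apply: cvgM; last exact: continuous_normal_pdf01.
  by apply: cvgB; [exact: exprn_continuous|exact: cvg_cst].
- have /(_ _) := cvgN mul_normal_pdf01_cvg0; rewrite oppr0; apply.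
- by move=> x _; have := is_derive_mul_normal_pdf01 x.
- apply: cvg_at_right_filter; apply: cvgN; exact: continuous_mul_normal_pdf01.
- move=> x _; rewrite derive1E; have dx := is_derive_mul_normal_pdf01 x.
  rewrite derive_val. ring.
Qed.

Lemma integral_1_sub_sq_normal_pdf01 :
  (\int[mu]_(x in `[0%R, 1%R]) ((1 - x ^+ 2) * phi x)%:E = (phi 1)%:E)%E.
Proof.
rewrite (@continuous_FTC2 _ _ (fun x => x * phi x)).
- by rewrite mul1r mul0r sube0.
- exact: ltr01.
- apply: continuous_subspaceT => x; apply: cvgM; last exact: continuous_normal_pdf01.
  by apply: cvgB; [exact: cvg_cst|exact: exprn_continuous].
- split.
  + by move=> x _; have := is_derive_mul_normal_pdf01 x.
  + by apply: cvg_at_right_filter; exact: continuous_mul_normal_pdf01.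
  + by apply: cvg_at_left_filter; exact: continuous_mul_normal_pdf01.
- move=> x _; rewrite derive1E; have dx := is_derive_mul_normal_pdf01 x.
  by rewrite derive_val.
Qed.

(** By parity it suffices to compare [x ^+ 2 * phi x] with [phi x] on the
    half-line. The excess of the former over the latter on [[1, +oo[] and its
    deficit on [[0, 1]] are both [phi 1], so they cancel. *)
Lemma normal_prob01_second_moment :
  (\int[normal_prob 0 1]_x (x ^+ 2)%:E = 1 :> \bar R)%E.
Proof.
rewrite ge0_integral_normal_prob; last 2 first.
  by apply/measurable_EFinP; exact: measurable_funX.
  by move=> x; rewrite lee_fin sqr_ge0.
rewrite -(integral_normal_pdf 0 1).
have f0 x : 0 <= x ^+ 2 * phi x by rewrite mulr_ge0 ?sqr_ge0 ?normal_pdf_ge0.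
have cf := continuous_sq_mul_normal_pdf01.
have cp := continuous_normal_pdf01.
have p0 := @normal_pdf_ge0 R 0 1.
under eq_integral do rewrite -EFinM.
rewrite ge0_symfun_integralT//; last by move=> x /=; rewrite sqrrN normal_pdf01N.
rewrite [RHS]ge0_symfun_integralT//; last by move=> x /=; rewrite normal_pdf01N.
congr *%E; rewrite -set_itvcy.
have mp : measurable_fun [set: R] phi by exact: measurable_normal_pdf.
have mf : measurable_fun [set: R] (fun x : R => x ^+ 2 * phi x).
  exact: continuous_measurable_fun.
rewrite !ge0_integral_split1//.
have mB g : measurable_fun [set: R] g -> forall A : set R, measurable_fun A (EFin \o g).
  by move=> mg A; apply/measurable_EFinP; exact: measurable_funTS.
have -> : (\int[mu]_(x in `[1%R, +oo[) (x ^+ 2 * phi x)%:E =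
    (phi 1)%:E + \int[mu]_(x in `[1%R, +oo[) (phi x)%:E)%E.
  rewrite -integral_sq_sub1_normal_pdf01 -ge0_integralD//=.
  - by apply: eq_integral => x _; rewrite -EFinD mulrBl mul1r subrK.
  - move=> x; rewrite in_itv/= andbT => x1.
    by rewrite lee_fin mulr_ge0// subr_ge0 exprn_ege1.
  - apply: mB; apply: measurable_funM => //; apply: measurable_funB => //.
  - by move=> x _; rewrite lee_fin.
  - exact: mB.
have <- : (\int[mu]_(x in `[0%R, 1%R]) (x ^+ 2 * phi x)%:E + (phi 1)%:E =
    \int[mu]_(x in `[0%R, 1%R]) (phi x)%:E)%E.
  rewrite -integral_1_sub_sq_normal_pdf01 -ge0_integralD//=.
  - by apply: eq_integral => x _; rewrite -EFinD mulrBl mul1r subrKC.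
  - by move=> x _; rewrite lee_fin.
  - exact: mB.
  - move=> x; rewrite in_itv/= => /andP[x0 x1].
    by rewrite lee_fin mulr_ge0// subr_ge0 exprn_ile1.
  - apply: mB; apply: measurable_funM => //; apply: measurable_funB => //.
by rewrite addeA.
Qed.

Lemma normal_prob01_oppr (A : set R) : measurable A ->
  normal_prob 0 1 (-%R @^-1` A) = normal_prob 0 1 A :> \bar R.
Proof.
move=> mA; rewrite /normal_prob.
transitivity (\int[mu]_(x in (-%R : _ -> measurableTypeR R) @^-1` A)
    ((EFin \o phi) \o (-%R : _ -> measurableTypeR R)) x)%E.
  by apply: eq_integral => x _ /=; rewrite normal_pdf01N.
rewrite -ge0_integral_pushforward//=.
- by apply: eq_measure_integral => B mB _; exact: lebesgue_measureN.
- apply/measurable_EFinP/measurable_funTS; exact: measurable_normal_pdf.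
- by move=> x _; rewrite lee_fin normal_pdf_ge0.
Qed.

(** The reflection [x |-> - x] preserves the measure and changes the sign of
    the integral. *)
Lemma normal_prob01_mean : (normal_prob 0 1).-integrable [set: R] EFin ->
  (\int[normal_prob 0 1]_x x%:E = 0 :> \bar R)%E.
Proof.
move=> i1.
set I := (X in X = _).
have iN : (normal_prob 0 1).-integrable [set: R] (EFin \o (-%R : R -> R)).
  by have := integrableN i1.
have IN : (I = - I)%E.
  transitivity (\int[pushforward (normal_prob 0 1) (-%R : _ -> measurableTypeR R)]_x x%:E)%E.
    by apply: eq_measure_integral => A mA _; exact/esym/normal_prob01_oppr.
  rewrite integral_pushforward//=.
  rewrite preimage_setT; under eq_integral do rewrite EFinN.
  by rewrite integralN//; exact: integrable_add_def.
have : I \is a fin_num by exact: integrable_fin_num.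
move: IN; case: I => [r| |]// [/eqP]; rewrite -subr_eq0 opprK -mulr2n.
by rewrite mulrn_eq0 => /eqP ->.
Qed.

End NormalMoments.

(** * Independent variables and Gaussian mixed moments *)

Section Independence.
Context (d : measure_display) (T : measurableType d) (R : realType).
Context (P : probability T R).

Lemma mutually_independent_pair (I : finType) (X : I -> {RV P >-> R}) (i j : I)
    (A B : set R) : mutually_independent X -> i != j ->
  measurable A -> measurable B ->
  P (X i @^-1` A `&` X j @^-1` B) = (P (X i @^-1` A) * P (X j @^-1` B))%E.
Proof.
move=> indX ij mA mB.
pose C k : set R := if k == i then A else B.
have mC k : measurable (C k) by rewrite /C; case: ifP.
have Ci : C i = A by rewrite /C eqxx.
have Cj : C j = B by rewrite /C eq_sym (negbTE ij).
have := indX [set i; j]%SET C mC.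
rewrite big_setU1 ?inE//= big_set1 Ci Cj => <-; congr (P _).
rewrite -Ci -Cj; apply/seteqP; split=> [t [ti tj] k /=|t tC].
  by rewrite !inE => /orP[] /eqP ->.
by split; apply: tC; rewrite /= !inE eqxx ?orbT.
Qed.

(** Independence says that the law of the pair [(X, Y)] agrees with the product
    of the laws on rectangles, hence everywhere; Fubini then splits the
    integral of [x * y]. *)
Lemma expectation_mul_indep (X Y : {RV P >-> R}) :
  (forall A B : set R, measurable A -> measurable B ->
    P (X @^-1` A `&` Y @^-1` B) = (P (X @^-1` A) * P (Y @^-1` B))%E) ->
  (X : T -> R) \in Lfun P 1 -> (Y : T -> R) \in Lfun P 1 ->
  (X \* Y)%R \in Lfun P 1 ->
  ('E_P[X \* Y] = 'E_P[X] * 'E_P[Y])%E.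
Proof.
move=> indXY /Lfun1_integrable iX /Lfun1_integrable iY /Lfun1_integrable iXY.
pose Z t := (X t, Y t); have mZ : measurable_fun [set: T] Z.
  by apply: measurable_fun_pair.
pose f (z : measurableTypeR R * measurableTypeR R) : \bar R := (z.1 * z.2)%:E.
have mf : measurable_fun [set: measurableTypeR R * measurableTypeR R] f.
  by apply/measurable_EFinP; apply: measurable_funM.
pose mX := distribution P X; pose mY := distribution P Y.
have prodE A : measurable A -> (mX \x mY)%E A = pushforward P Z A.
  by move=> mA; exact: product_measure_unique.
have iZ : (pushforward P Z).-integrable [set: _] f.
  by apply: integrable_pushforward.
have iprod : (mX \x mY)%E.-integrable [set: _] f.
  apply/integrableP; split => //.
  have /integrableP[_] := iZ; apply: le_lt_trans; rewrite le_eqVlt.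
  apply/orP; left; apply/eqP; apply: eq_measure_integral => A mA _.
  exact: prodE.
have iY' : mY.-integrable [set: _] EFin by apply: integrable_pushforward.
rewrite unlock.
transitivity (\int[pushforward P Z]_z f z)%E.
  by rewrite integral_pushforward.
transitivity (\int[mX \x mY]_z f z)%E.
  by apply: eq_measure_integral => A mA _; exact/esym/prodE.
rewrite -integral12_prod_meas1// /fubini_F.
have EY : (\int[mY]_y y%:E = \int[P]_t (Y t)%:E)%E.
  by rewrite integral_distribution.
under eq_integral => x _.
  rewrite /f /=; under eq_integral do rewrite EFinM.
  rewrite integralZl//= EY. over.
have fY : (\int[P]_t (Y t)%:E)%E \is a fin_num by exact: integrable_fin_num.
rewrite -(fineK fY) integralZr//; last by apply: integrable_pushforward.
by congr (_ * _)%E; rewrite integral_distribution.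
Qed.

Lemma sqr_integrable_Lfun2 (X : {RV P >-> R}) :
  (\int[P]_t (X t ^+ 2)%:E < +oo)%E -> (X : T -> R) \in Lfun P 2%:E.
Proof.
move=> X2; rewrite inE; apply/andP; split; rewrite inE//=.
rewrite /finite_norm unlock /=; apply: poweR_lty.
rewrite (eq_integral (fun t => (X t ^+ 2)%:E))// => t _ /=.
by rewrite powR_mulrn// real_normK// num_real.
Qed.

(** All cross terms of the expanded square integrate to zero. *)
Lemma expectation_sqr_lincomb n (X : 'I_n -> {RV P >-> R}) (a : 'I_n -> R) :
  (forall j, (X j : T -> R) \in Lfun P 2%:E) ->
  (forall i j, ('E_P[X i \* X j] = ((i == j)%:R)%:E)%E) ->
  ('E_P[fun t => ((\sum_j a j * X j t) ^+ 2)%R] = (\sum_j a j ^+ 2)%R%:E)%E.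
Proof.
move=> X2 XX.
have iXX i j : P.-integrable [set: T] (EFin \o (X i \* X j)).
  exact/Lfun1_integrable/Lfun2_mul_Lfun1.
have iaXX i j : P.-integrable [set: T] (fun t => (a i * a j)%:E * (X i t * X j t)%:E)%E.
  exact: (integrableZl measurableT (a i * a j) (iXX i j)).
have EaXX i j : (\int[P]_t ((a i * a j)%:E * (X i t * X j t)%:E) =
    (a i * a j * (i == j)%:R)%:E)%E.
  rewrite (integralZl measurableT (iXX i j)) EFinM.
  by have := XX i j; rewrite unlock => ->.
rewrite unlock.
transitivity (\int[P]_t (\sum_i \sum_j ((a i * a j)%:E * (X i t * X j t)%:E)))%E.
  apply: eq_integral => t _; rewrite expr2 mulr_suml -sumEFin.
  apply: eq_bigr => i _; rewrite mulr_sumr -sumEFin; apply: eq_bigr => j _.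
  by rewrite -EFinM mulrACA.
rewrite integral_sum//; last by move=> i; exact: integrable_sum.
rewrite -sumEFin; apply: eq_bigr => i _; rewrite integral_sum//.
rewrite (bigD1 i)//= big1 ?adde0 => [|j ji].
  by rewrite EaXX eqxx mulr1 expr2.
by rewrite EaXX eq_sym (negbTE ji) mulr0.
Qed.

(** [normal_prob] lives on [measurableTypeR R], whose measurable structure
    carries another display than the one of [R] used for random variables. The
    variable [X'] is [X] with its codomain seen in the former way, so that the
    law of [X] can be compared with [normal_prob] as a measure. *)
Lemma standard_normal_pushforward (X : {RV P >-> R}) (X' : T -> measurableTypeR R) :
    X' =1 X -> standard_normal X ->
  measurable_fun [set: T] X' /\
  forall A, measurable A -> pushforward P X' A = normal_prob 0 1 A.
Proof.
move=> /funext -> nX; split; first exact: (measurable_funPT X).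
by move=> A mA; exact: nX.
Qed.

Lemma standard_normal_Lfun2 (X : {RV P >-> R}) : standard_normal X ->
  (X : T -> R) \in Lfun P 2%:E /\ ('E_P[X \* X] = 1)%E.
Proof.
move=> nX.
have [mX' X'E] := @standard_normal_pushforward X X (fun=> erefl) nX.
set X' : T -> measurableTypeR R := X in mX' X'E.
have X2 : (\int[P]_t (X t ^+ 2)%:E = 1)%E.
  rewrite -(normal_prob01_second_moment R).
  transitivity (\int[pushforward P X']_x (x ^+ 2)%:E)%E.
    rewrite ge0_integral_pushforward//.
      by apply/measurable_EFinP; exact: measurable_funX.
    by move=> x _; rewrite lee_fin sqr_ge0.
  by apply: eq_measure_integral => A mA _; exact: X'E.
split; first by apply: sqr_integrable_Lfun2; rewrite X2 ltry.
by rewrite unlock -X2; apply: eq_integral => t _; rewrite expr2.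
Qed.

Lemma standard_normal_mean (X : {RV P >-> R}) : standard_normal X ->
  ('E_P[X] = 0)%E.
Proof.
move=> nX; have [X2 _] := standard_normal_Lfun2 nX.
have iX : P.-integrable [set: T] (EFin \o X).
  by apply/Lfun1_integrable; apply: Lfun_subset12 X2; rewrite fin_num_measure.
have [mX' X'E] := @standard_normal_pushforward X X (fun=> erefl) nX.
set X' : T -> measurableTypeR R := X in mX' X'E.
have iD : (pushforward P X').-integrable [set: _] EFin.
  exact: integrable_pushforward.
rewrite unlock; transitivity (\int[pushforward P X']_x x%:E)%E.
  by rewrite integral_pushforward.
rewrite -[RHS]normal_prob01_mean.
  by apply: eq_measure_integral => A mA _; exact: X'E.
apply/integrableP; split => //; have /integrableP[_] := iD.
apply: le_lt_trans; rewrite le_eqVlt; apply/orP; left; apply/eqP.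
by apply: eq_measure_integral => A mA _; exact/esym/X'E.
Qed.

Lemma standard_normal_orthonormal (I : finType) (X : I -> {RV P >-> R}) (i j : I) :
  (forall i, standard_normal (X i)) -> mutually_independent X ->
  ('E_P[X i \* X j] = ((i == j)%:R)%:E)%E.
Proof.
move=> nX indX; have [<-|ij] := eqVneq i j.
  by have [_ ->] := standard_normal_Lfun2 (nX i).
have L1 k : (X k : T -> R) \in Lfun P 1.
  have [X2 _] := standard_normal_Lfun2 (nX k).
  by apply: Lfun_subset12 X2; rewrite fin_num_measure.
rewrite expectation_mul_indep//.
- by rewrite standard_normal_mean ?mul0e.
- by move=> A B mA mB; exact: mutually_independent_pair.
- apply: Lfun2_mul_Lfun1.
    by have [] := standard_normal_Lfun2 (nX i).
  by have [] := standard_normal_Lfun2 (nX j).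
Qed.

End Independence.

(** * Mean squared norm of the image of a random vector *)

Section RandomImage.
Context (R : realType).

Lemma normc_sq_ReIm (z : R[i]) :
  Normc.normc z ^+ 2 = complex.Re z ^+ 2 + complex.Im z ^+ 2.
Proof. by case: z => a b; rewrite /= sqr_sqrtr// addr_ge0 ?sqr_ge0. Qed.

Lemma norm2_sq m (v : 'cV[R[i]]_m) :
  norm2 v ^+ 2 = \sum_i (complex.Re (v i 0) ^+ 2 + complex.Im (v i 0) ^+ 2).
Proof.
rewrite sqr_sqrtr; last by apply: sumr_ge0 => i _; exact: sqr_ge0.
by apply: eq_bigr => i _; rewrite normc_sq_ReIm.
Qed.

Lemma Re_mulmx_real m n (M : 'M[R[i]]_(m, n)) (w : 'cV[R]_n) i :
  complex.Re ((M *m map_mx (real_complex R) w) i 0) =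
  \sum_j complex.Re (M i j) * w j 0.
Proof.
rewrite mxE (big_morph (@complex.Re R) (id1 := 0) (op1 := +%R))//; last by case=> ? ? [].
by apply: eq_bigr => j _; rewrite mxE; case: (M i j) => a b /=; rewrite mulr0 subr0.
Qed.

Lemma Im_mulmx_real m n (M : 'M[R[i]]_(m, n)) (w : 'cV[R]_n) i :
  complex.Im ((M *m map_mx (real_complex R) w) i 0) =
  \sum_j complex.Im (M i j) * w j 0.
Proof.
rewrite mxE (big_morph (@complex.Im R) (id1 := 0) (op1 := +%R))//; last by case=> ? ? [].
by apply: eq_bigr => j _; rewrite mxE; case: (M i j) => a b /=; rewrite mulr0 add0r.
Qed.

(** The real and imaginary parts of each entry of the image are real linear
    combinations of the [X j]. *)
Lemma expectation_norm2_sq (d : measure_display) (T : measurableType d)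
    (P : probability T R) m n (M : 'M[R[i]]_(m, n)) (X : 'I_n -> {RV P >-> R}) :
  (forall j, (X j : T -> R) \in Lfun P 2%:E) ->
  (forall i j, ('E_P[X i \* X j] = ((i == j)%:R)%:E)%E) ->
  ('E_P[fun t => (norm2 (M *m map_mx (real_complex R) (\col_j X j t)) ^+ 2)%R] =
   (normF M ^+ 2)%R%:E)%E.
Proof.
move=> X2 XX.
have mlin (a : 'I_n -> R) :
    measurable_fun [set: T] (fun t => ((\sum_j a j * X j t) ^+ 2)%:E).
  apply/measurable_EFinP; apply: measurable_funX; apply: measurable_sum => j.
  by apply: measurable_funM.
have Elin a := expectation_sqr_lincomb a X2 XX.
rewrite unlock in Elin *.
transitivity (\int[P]_t (\sum_i
    (((\sum_j complex.Re (M i j) * X j t) ^+ 2)%:E +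
     ((\sum_j complex.Im (M i j) * X j t) ^+ 2)%:E)))%E.
  apply: eq_integral => t _; rewrite norm2_sq -sumEFin; apply: eq_bigr => i _.
  rewrite Re_mulmx_real Im_mulmx_real EFinD.
  by congr (_%:E + _%:E)%E; congr (_ ^+ 2); apply: eq_bigr => j _; rewrite mxE.
rewrite ge0_integral_sum//; last 2 first.
- by move=> i; apply: emeasurable_funD; exact: mlin.
- by move=> i t _; rewrite adde_ge0// lee_fin sqr_ge0.
rewrite normF_sq -sumEFin; apply: eq_bigr => i _.
rewrite ge0_integralD//; last 2 first.
- by move=> t _; rewrite lee_fin sqr_ge0.
- by move=> t _; rewrite lee_fin sqr_ge0.
rewrite !Elin -EFinD -big_split/=; congr EFin.
by apply: eq_bigr => j _; rewrite normc_sq_ReIm.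
Qed.

End RandomImage.

(** * The re-normalization algorithm and the eps-rank *)

Section Algorithm.
Context (R : realType) (m n : nat) (A : 'M[R[i]]_(m, n)).

Lemma size_grr (ws : 'I_n -> 'cV[R]_n) (k : nat) qs : (k <= n)%N ->
  grr A ws k = Some qs -> size qs = k.
Proof.
move=> kn.
have foldl_None s : foldl (grr_step A) None s = None by elim: s.
have size_foldl s qs0 : foldl (grr_step A) (Some qs0) s = Some qs ->
    size qs = (size qs0 + size s)%N.
  elim: s qs0 => [|w s IH] qs0 /=; first by case=> ->; rewrite addn0.
  case: ifP => _; last by rewrite foldl_None.
  by move=> /IH ->; rewrite size_rcons addSnnS.
move=> /size_foldl ->; rewrite size_map size_filter.
rewrite -(count_map val (fun l => l < k)%N) val_enum_ord -size_filter.
suff -> : [seq l <- iota 0 n | (l < k)%N] = iota 0 k by rewrite size_iota.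
rewrite -(subnKC kn) iotaD filter_cat.
rewrite (all_filterP _); last by apply/allP => l; rewrite mem_iota.
rewrite -[RHS]cats0; congr (_ ++ _); apply/eqP; rewrite -size_eq0 size_filter.
rewrite -leqn0 leqNgt -has_count; apply/hasPn => l.
by rewrite mem_iota add0n -leqNgt => /andP[].
Qed.

Lemma grr_Q_projector (k : nat) (qs : seq 'cV[R[i]]_m) : size qs = k ->
  \sum_(q <- qs) q *m q^t* = grr_Q k qs *m (grr_Q k qs)^t*.
Proof.
move=> <-; apply/matrixP => i j; rewrite summxE mxE (big_nth 0) big_mkord.
by apply: eq_bigr => l _; rewrite !mxE big_ord1 !mxE.
Qed.

End Algorithm.

Lemma big_minn_le (r : seq nat) (p k : nat) (Q : pred nat) : k \in r -> Q k ->
  (\big[minn/p]_(s <- r | Q s) s <= k)%N.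
Proof.
elim: r => // s r IH; rewrite inE big_cons => /predU1P[<- ->|/IH kr /kr kk].
  exact: geq_minl.
by case: ifP => // _; rewrite geq_min kk orbT.
Qed.

Lemma big_minn_le_idx (r : seq nat) (p : nat) (Q : pred nat) :
  (\big[minn/p]_(s <- r | Q s) s <= p)%N.
Proof.
elim: r => [|s r IH]; first by rewrite big_nil.
by rewrite big_cons; case: ifP => // _; rewrite geq_min IH orbT.
Qed.

Lemma big_minn_ge (r : seq nat) (p k : nat) (Q : pred nat) : (k <= p)%N ->
  (forall s, s \in r -> Q s -> (k <= s)%N) ->
  (k <= \big[minn/p]_(s <- r | Q s) s)%N.
Proof.
by move=> kp kr; rewrite big_seq_cond; elim/big_ind: _ => // [x y kx ky|s /andP[]];
  [rewrite leq_min kx|exact: kr].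
Qed.

Theorem lemma2p3 (R : realType) (m n : nat) (A : 'M[R[i]]_(m, n)) (hA : A != 0)
    (d : measure_display) (T : measurableType d) (P : probability T R)
    (omega : 'I_n -> 'I_n -> {RV P >-> R}) (homega : gaussian_draws omega)
    (k : 'I_n) (hk : (0 < k)%N)
    (t0 : T) (qs : seq 'cV[R[i]]_m)
    (hqs : grr A (draw omega t0) k = Some qs)
    (eps : R) (heps : 0 <= eps < 1) :
  let Q : 'M[R[i]]_(m, k) := grr_Q k qs in
  let Ahat : 'M[R[i]]_(m, n) := Q *m Q ^t* *m A in
  (('E_P[fun t => (grr_b A qs (draw omega t k) ^+ 2)%R]
      <= (normF A ^+ 2 * eps)%R%:E)%E
    <-> normF (A - Ahat) / normF A <= Num.sqrt eps)
  /\
  (normF (A - Ahat) / normF A <= Num.sqrt eps ->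
     [/\ 1 - eps <= energy_ratio A k,
         (eps_rank A eps <= k)%N
       & (forall s : nat, (0 < s < k)%N -> energy_ratio A s < 1 - eps) ->
         eps_rank A eps = k]).
Proof.
move=> Q Ahat; have [eps0 eps1] := andP heps.
have [normal_omega indep_omega] := homega.
have sq : size qs = k by apply: size_grr hqs; exact/ltnW/ltn_ord.
have A2 : 0 < normF A ^+ 2 by rewrite lt_neqAle sqr_ge0 eq_sym normF_sq_eq0 hA.
have A1 : 0 < normF A by rewrite lt_neqAle sqrtr_ge0 andbT eq_sym -sqrf_eq0 gt_eqF.
have tolE : (normF (A - Ahat) / normF A <= Num.sqrt eps) =
    (normF (A - Ahat) ^+ 2 <= normF A ^+ 2 * eps).
  rewrite ler_pdivrMr// -ler_sqr ?nnegrE ?mulr_ge0 ?sqrtr_ge0//.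
  by rewrite exprMn (sqr_sqrtr eps0) mulrC.
split.
  have -> : ('E_P[fun t => (grr_b A qs (draw omega t k) ^+ 2)%R] =
      (normF (A - Ahat) ^+ 2)%R%:E)%E.
    rewrite -(@expectation_norm2_sq _ _ _ P _ _ (A - Ahat) (omega k)).
    - congr expectation; apply/funext => t; rewrite /grr_b /grr_v.
      by rewrite (grr_Q_projector sq) mulmxBl mul1mx.
    - by move=> j; have [] := standard_normal_Lfun2 (normal_omega k j).
    - move=> i j.
      have := @standard_normal_orthonormal _ _ _ P _ (fun li => omega li.1 li.2)
        (k, i) (k, j) (fun li => normal_omega li.1 li.2) indep_omega.
      by rewrite xpair_eqE eqxx.
  by rewrite lee_fin tolE.
rewrite tolE => tol.
have ratioE s : energy_ratio A s = (\sum_(i < s) sigma A i ^+ 2) / normF A ^+ 2.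
  by rewrite /energy_ratio sum_sigma_sq.
have rank_Ahat : (\rank Ahat <= k)%N.
  by rewrite /Ahat -mulmxA (leq_trans (mxrankM_maxl _ _))// rank_leq_col.
have ratio_k : 1 - eps <= energy_ratio A k.
  rewrite ratioE ler_pdivlMr// mulrBl mul1r lerBlDr addrC -lerBlDr.
  by rewrite (le_trans (eckart_young A rank_Ahat))// mulrC.
have rank_le : (eps_rank A eps <= k)%N.
  have [kp|pk] := leqP k (minn m n).
    by apply: big_minn_le => //; rewrite mem_index_iota hk ltnS.
  exact: leq_trans (big_minn_le_idx _ _ _) (ltnW pk).
split=> // low; apply/eqP; rewrite eqn_leq rank_le /=.
(* Otherwise minn m n would be an earlier step, whose energy ratio is 1. *)
have kp : (k <= minn m n)%N.
  rewrite leqNgt; apply/negP => pk.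
  have p0 : (0 < minn m n)%N.
    have [p0|//] := posnP (minn m n); have := sum_sigma_sq A.
    by rewrite p0 big_ord0 => /eqP; rewrite eq_sym gt_eqF.
  have := low _ (introT andP (conj p0 pk)).
  rewrite ratioE sum_sigma_sq divff ?gt_eqF// ltNge => /negP; apply.
  by rewrite lerBlDr lerDl.
apply: big_minn_ge => // s; rewrite mem_index_iota => /andP[s0 _] hs.
rewrite leqNgt; apply/negP => sk.
by have := low s (introT andP (conj s0 sk)); rewrite ltNge hs.
Qed.
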